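(* Let $n \ge 1$ be an integer, let $X_1, \ldots, X_n$ be independent random variables uniformly distributed on $[0,1]$, and for $f \in F$ let $$\hat{S}_n^{\mathrm{cv}}(f) \;=\; \frac{1}{n} \sum_{i=1}^n \left( f(X_i) - X_i \right) + \frac{1}{2}.$$ Then the estimator $\hat{S}_n^{\mathrm{cv}}$ is unbiased, i.e. $\mathbb{E}(\hat{S}_n^{\mathrm{cv}}(f)) = S(f)$ for all $f \in F$, and it satisfies $$\left( e_2\left( \hat{S}_n^{\mathrm{cv}} \right) \right)^2 \;=\; \max_{f \in F}\, \mathrm{var}\left( \hat{S}_n^{\mathrm{cv}}(f) \right) \;=\; \frac{1}{12 n}.$$ The maximal error is attained for any unit step function.
   Context: Let $F$ be the class of all non-decreasing functions $f : [0,1] \to [0,1]$, and for $f \in F$ let $S(f) = \int_0^1 f(x)\,\mathrm{d}x$. For an estimator $\hat{S}_n$, the worst-case $L^2$ error over $F$ is $e_2(\hat{S}_n) = \sup_{f \in F} \mathbb{E}\left( | S(f) - \hat{S}_n(f) |^2 \right)^{1/2}$. A unit step function is a function of the form $f = \mathbf{1}_{[x_0, 1]}$ (indicator function on $[0,1]$), with jump at $x_0 \in [0,1]$. *)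

(* Defs.v *)
From HB Require Import structures.
From mathcomp Require Import all_boot all_order all_algebra.
From mathcomp Require Import all_classical all_reals all_analysis.

Set Implicit Arguments.
Unset Strict Implicit.
Unset Printing Implicit Defensive.

Import Order.TTheory GRing.Theory Num.Theory.
Import numFieldNormedType.Exports.

Local Open Scope classical_set_scope.
Local Open Scope ring_scope.

(* Functions [0,1] -> [0,1] are represented by total functions R -> R; their
   values outside [0,1] are unconstrained. *)
Definition monotone_class (R : realType) : set (R -> R) :=
  [set f | {in `[0, 1] &, {homo f : x y / x <= y}} /\
           (forall x : R, x \in `[0, 1] -> f x \in `[0, 1])].

Definition unit_step (R : realType) (x0 : R) : R -> R := \1_`[x0, 1].

Definition integral01 (R : realType) (f : R -> R) : R :=
  \int[@lebesgue_measure R]_(x in `[0, 1]) f x.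

Definition mutually_independent (R : realType) (d : measure_display)
    (T : measurableType d) (P : probability T R) (I : finType)
    (X : I -> {RV P >-> R}) : Prop :=
  forall (J : {set I}) (B : I -> set R), (forall i, measurable (B i)) ->
    P (\bigcap_(i in [set` J]) X i @^-1` B i) =
    (\prod_(i in J) P (X i @^-1` B i))%E.

(* The first condition says that X is [0,1]-valued, so that f (X t) makes sense
   for f defined on [0,1] only. *)
Definition uniform01 (R : realType) (d : measure_display)
    (T : measurableType d) (P : probability T R) (X : {RV P >-> R}) : Prop :=
  (forall t, X t \in `[0, 1]) /\
  (forall B, measurable B -> distribution P X B = uniform_prob (@ltr01 R) B).

Section Estimators.
Local Open Scope ereal_scope.
Context (R : realType) (d : measure_display) (T : measurableType d)
  (P : probability T R).

(* A randomized estimator maps an input f to a random variable on T. *)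
Implicit Type Shat : (R -> R) -> T -> R.

Definition unbiased Shat : Prop :=
  forall f, monotone_class f -> 'E_P[Shat f] = (integral01 f)%:E.

Definition L2_error Shat (f : R -> R) : \bar R :=
  'E_P[fun t => (`|integral01 f - Shat f t| ^+ 2)%R] `^ 2^-1.

Definition e2 Shat : \bar R :=
  ereal_sup [set L2_error Shat f | f in @monotone_class R].

End Estimators.

Definition is_max (R : realType) (A : set (\bar R)) (m : \bar R) : Prop :=
  A m /\ ubound A m.

Definition control_variate (R : realType) (T : Type) (n : nat)
    (X : 'I_n -> T -> R) (f : R -> R) (t : T) : R :=
  n%:R^-1 * (\sum_(i < n) (f (X i t) - X i t)) + 2^-1.

(* Main.v *)
Require Import Defs.
From HB Require Import structures.
From mathcomp Require Import all_boot all_order all_algebra.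
From mathcomp Require Import all_classical all_reals all_analysis.
From mathcomp Require Import measurable_realfun lra.

Set Implicit Arguments.
Unset Strict Implicit.

Import Order.TTheory GRing.Theory Num.Theory.
Import numFieldNormedType.Exports.

Local Open Scope classical_set_scope.
Local Open Scope ring_scope.

(** Subtracting the control variate turns the problem into one about the
    function g(x) = f(x) - x: the error of the estimator on f is the sample
    mean of the centered variables h(X_i), where h = g - E(g(X)) and X is
    uniform.  Unbiasedness follows by linearity.  Pairwise independence kills
    the mixed terms of the square (lemma [mean_sqr_sample_mean]), so the mean
    squared error, which is also the variance, equals var(g(X)) / n.

    It remains to see that var(f(X) - X) <= 1/12.  Let X, Y be independent and
    uniform on [0,1].  For a non-decreasing f, the absolute difference is
      |f(X) - f(Y)| = f(X) s(X,Y) + f(Y) s(Y,X),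
    where s(x,y) is the sign of x - y.  The mean of s(x,Y) is 2x - 1, and
    exchanging X and Y (Fubini) gives Gini's formula
      E|f(X) - f(Y)| = 2 E(f(X)(2X - 1)) = 4 cov(f(X), X).
    On the other hand E(f(X) - f(Y))^2 = 2 var(f(X)).  Hence
      var(f(X) - X) = var(X) + var(f(X)) - 2 cov(f(X), X)
                    = 1/12 - E(|f(X) - f(Y)| - |f(X) - f(Y)|^2) / 2,
    which is [variance_control_variate].  Because |f(X) - f(Y)| <= 1, the
    subtracted deficit is nonnegative ([variance_deficit_ge0]), and it vanishes
    when f takes only the values 0 and 1 ([variance_deficit_indic]), which is
    the case for unit steps.

    Inputs are constrained on [0,1] only, so each f is replaced by its
    composition with the retraction [clamp01] of the line onto [0,1].  The
    composition is non-decreasing on the whole line, hence measurable, and it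
    agrees with f wherever the estimator and the integral look at f. *)

(** * Bounded measurable functions and their means *)

(** Bounded measurable functions form an algebra on which all means under a
    probability are finite; every integrand below belongs to it, so that
    linearity and Fubini apply with no further integrability argument. *)
Definition bounded_measurable {R : realType} {d : measure_display}
    {T : measurableType d} (f : T -> R) : Prop :=
  measurable_fun setT f /\ exists M, forall x, `|f x| <= M.

Section BoundedMeasurable.
Context {R : realType} {d : measure_display} {T : measurableType d}.
Implicit Types (f g : T -> R) (k : R).

Lemma bounded_measurable_cst k : bounded_measurable (fun _ : T => k).
Proof. by split; [exact: measurable_cst | exists `|k|]. Qed.

Lemma bounded_measurableD f g :
  bounded_measurable f -> bounded_measurable g ->
  bounded_measurable (fun x => f x + g x).
Proof.
move=> [mf [M fM]] [mg [N gN]]; split; first exact: measurable_funD.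
by exists (M + N) => x; rewrite (le_trans (ler_normD _ _))// lerD.
Qed.

Lemma bounded_measurableM f g :
  bounded_measurable f -> bounded_measurable g ->
  bounded_measurable (fun x => f x * g x).
Proof.
move=> [mf [M fM]] [mg [N gN]]; split; first exact: measurable_funM.
by exists (M * N) => x; rewrite normrM ler_pM.
Qed.

Lemma bounded_measurableB f g :
  bounded_measurable f -> bounded_measurable g ->
  bounded_measurable (fun x => f x - g x).
Proof.
move=> [mf [M fM]] [mg [N gN]]; split; first exact: measurable_funB.
by exists (M + N) => x; rewrite (le_trans (ler_normB _ _))// lerD.
Qed.

Lemma bounded_measurableX f n :
  bounded_measurable f -> bounded_measurable (fun x => f x ^+ n).
Proof.
move=> [mf [M fM]]; split; first exact: measurable_funX.
by exists (M ^+ n) => x; rewrite normrX lerXn2r// nnegrE (le_trans _ (fM x)).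
Qed.

Lemma bounded_measurable_norm f :
  bounded_measurable f -> bounded_measurable (fun x => `|f x|).
Proof.
move=> [mf [M fM]]; split; first exact: measurableT_comp.
by exists M => x; rewrite normr_id.
Qed.

Lemma bounded_measurable_sum I (s : seq I) (F : I -> T -> R) :
  (forall i, bounded_measurable (F i)) ->
  bounded_measurable (fun x => \sum_(i <- s) F i x).
Proof.
move=> bF; elim: s => [|i s IHs].
  under eq_fun do rewrite big_nil; exact: bounded_measurable_cst.
under eq_fun do rewrite big_cons; exact: bounded_measurableD.
Qed.

Lemma bounded_measurable_ltr f g : measurable_fun setT f ->
  measurable_fun setT g -> bounded_measurable (fun x => (f x < g x)%R%:R : R).
Proof.
move=> mf mg; split; last first.
  by exists 1 => x; case: (_ < _); rewrite ?normr1// normr0.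
have mlt := measurable_fun_ltr mf mg.
pose A := [set x | f x < g x].
have -> : (fun x => (f x < g x)%R%:R) = \1_A :> (T -> R).
  apply/funext => x; rewrite indicE; congr ((nat_of_bool _)%:R).
  by apply/idP/idP; rewrite inE.
apply: measurable_indic.
by have := mlt measurableT [set true] I; rewrite setTI.
Qed.

Lemma bounded_measurable_comp d' (T' : measurableType d') (h : T' -> T) f :
  measurable_fun setT h -> bounded_measurable f ->
  bounded_measurable (fun x => f (h x)).
Proof.
by move=> mh [mf [M fM]]; split; [exact: measurableT_comp | exists M].
Qed.

End BoundedMeasurable.

Section ProbabilityIntegral.
Context {R : realType} {d : measure_display} {T : measurableType d}.
Variable P : probability T R.
Implicit Types (f g : T -> R) (k : R).

Lemma bounded_measurable_integrable f :
  bounded_measurable f -> P.-integrable setT (EFin \o f).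
Proof.
move=> [mf [M fM]]; apply: measurable_bounded_integrable => //.
  by rewrite [ltLHS]probability_setT ltry.
exists M; split; rewrite ?num_real// => N MN x _.
exact: le_trans (fM x) (ltW MN).
Qed.
Local Notation integrable := bounded_measurable_integrable.

Lemma integral_Rintegral f : bounded_measurable f ->
  (\int[P]_x (f x)%:E)%E = (\int[P]_x f x)%:E.
Proof.
move=> bf; rewrite /Rintegral fineK//.
by apply: integrable_fin_num => //; exact: integrable.
Qed.

Lemma expectation_Rintegral f : bounded_measurable f ->
  'E_P[f]%E = (\int[P]_x f x)%:E.
Proof. by move=> bf; rewrite unlock integral_Rintegral. Qed.

Lemma meanC k : \int[P]_x k = k.
Proof. by rewrite Rintegral_cst// [X in fine X]probability_setT mulr1. Qed.

Lemma meanD f g : bounded_measurable f -> bounded_measurable g ->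
  \int[P]_x (f x + g x) = \int[P]_x f x + \int[P]_x g x.
Proof. by move=> bf bg; rewrite RintegralD//; exact: integrable. Qed.

Lemma meanB f g : bounded_measurable f -> bounded_measurable g ->
  \int[P]_x (f x - g x) = \int[P]_x f x - \int[P]_x g x.
Proof. by move=> bf bg; rewrite RintegralB//; exact: integrable. Qed.

Lemma meanZ k f : bounded_measurable f ->
  \int[P]_x (k * f x) = k * \int[P]_x f x.
Proof. by move=> bf; rewrite RintegralZl//; exact: integrable. Qed.

Lemma mean_sum I (s : seq I) (F : I -> T -> R) :
  (forall i, bounded_measurable (F i)) ->
  \int[P]_x (\sum_(i <- s) F i x) = \sum_(i <- s) \int[P]_x F i x.
Proof.
move=> bF; elim: s => [|i s IHs].
  by under eq_Rintegral do rewrite big_nil; rewrite meanC big_nil.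
under eq_Rintegral do rewrite big_cons.
by rewrite big_cons meanD// ?IHs//; exact: bounded_measurable_sum.
Qed.

End ProbabilityIntegral.

#[local] Hint Resolve bounded_measurable_cst bounded_measurableD
  bounded_measurableM bounded_measurableB bounded_measurableX
  bounded_measurable_norm : bmeas.

(** * Iterated means and independence *)

Section Fubini.
Context {R : realType} {d1 d2 : measure_display}
  {T1 : measurableType d1} {T2 : measurableType d2}.
Variables (P1 : probability T1 R) (P2 : probability T2 R).

Let integrable_prod (f : T1 * T2 -> R) : bounded_measurable f ->
  (P1 \x P2)%E.-integrable setT (EFin \o f).
Proof. exact: (@bounded_measurable_integrable _ _ _ (P1 \x P2)%E). Qed.

Lemma Rintegral_prod (f : T1 * T2 -> R) : bounded_measurable f ->
  \int[(P1 \x P2)%E]_z f z = \int[P1]_x \int[P2]_y f (x, y).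
Proof.
move=> bf; rewrite /Rintegral -(integral12_prod_meas1 (integrable_prod bf)).
congr fine; apply: eq_integral => x _; rewrite /fubini_F/= integral_Rintegral//.
exact: bounded_measurable_comp (pair1_measurable x) bf.
Qed.

Lemma Fubini_bounded (f : T1 * T2 -> R) : bounded_measurable f ->
  \int[P1]_x \int[P2]_y f (x, y) = \int[P2]_y \int[P1]_x f (x, y).
Proof.
move=> bf; rewrite -Rintegral_prod//.
rewrite /Rintegral -(integral21_prod_meas1 (integrable_prod bf)).
congr fine; apply: eq_integral => x _; rewrite /fubini_G/= integral_Rintegral//.
exact: bounded_measurable_comp (pair2_measurable x) bf.
Qed.

End Fubini.

Section Distribution.
Context {R : realType} {d d' : measure_display} {T : measurableType d}
  {T' : measurableType d'}.
Variable P : probability T R.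

(** The law is only required to agree with [Q] on measurable sets, because [Q]
    need not be syntactically the image measure: identically distributed
    variables all share one [Q]. *)
Lemma mean_distribution (X : {RV P >-> T'}) (Q : probability T' R) f :
  (forall B, measurable B -> distribution P X B = Q B) ->
  bounded_measurable f -> \int[P]_t f (X t) = \int[Q]_x f x.
Proof.
move=> XQ bf; rewrite /Rintegral; congr fine; apply/esym.
rewrite -(@eq_measure_integral _ _ _ _ _ (distribution P X)); last first.
  by move=> A mA _; exact: XQ.
rewrite integral_distribution//; first by apply/measurable_EFinP; case: bf.
by apply/bounded_measurable_integrable/bounded_measurable_comp.
Qed.

End Distribution.

Section Independence.
Context {R : realType} {d d' : measure_display} {T : measurableType d}
  {T' : measurableType d'}.
Variable P : probability T R.

(** The law of the pair agrees with the product of the marginal laws on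
    rectangles, hence on all measurable sets; Fubini then factors the mean. *)
Lemma mean_indep (X Y : {RV P >-> T'}) g h :
  (forall A B, measurable A -> measurable B ->
    P (X @^-1` A `&` Y @^-1` B) = P (X @^-1` A) * P (Y @^-1` B))%E ->
  bounded_measurable g -> bounded_measurable h ->
  \int[P]_t (g (X t) * h (Y t)) = \int[P]_t g (X t) * \int[P]_t h (Y t).
Proof.
move=> XY bg bh.
have mZ : measurable_fun setT (fun t => (X t, Y t)).
  exact: measurable_fun_pair.
pose Z : {mfun T >-> (T' * T')%type} := mfun_Sub (mem_set mZ).
have ZE : forall D, measurable D ->
    distribution P Z D = (distribution P X \x distribution P Y)%E D.
  move=> D mD; apply/esym/product_measure_unique => // A B; exact: XY.
pose f (z : T' * T') := g z.1 * h z.2.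
have bf : bounded_measurable f.
  apply: bounded_measurableM; [apply: bounded_measurable_comp bg => //|].
  exact: bounded_measurable_comp bh.
have distE (W : {RV P >-> T'}) k : bounded_measurable k ->
    \int[P]_t k (W t) = \int[distribution P W]_x k x.
  by move=> bk; exact: mean_distribution.
pose Q : probability (T' * T')%type R :=
  (distribution P X \x distribution P Y)%E.
rewrite (@mean_distribution _ _ _ _ _ _ Z Q f ZE bf :
  \int[P]_t (g (X t) * h (Y t)) = _).
rewrite Rintegral_prod// /f/=.
under eq_Rintegral do rewrite meanZ//.
rewrite !distE//.
by under eq_Rintegral do rewrite mulrC; rewrite meanZ// mulrC.
Qed.

End Independence.

(** * The retraction onto the unit interval *)

Definition clamp01 (R : realType) (x : R) : R := Num.max 0 (Num.min x 1).

Section Clamp.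
Variable R : realType.
Implicit Types x y : R.

Lemma clamp01_itv x : clamp01 x \in `[0, 1].
Proof.
rewrite in_itv/= /clamp01 le_max lexx/= ge_max ler01/=.
by rewrite ge_min lexx orbT.
Qed.

Lemma clamp01_id x : x \in `[0, 1] -> clamp01 x = x.
Proof.
by rewrite in_itv/= /clamp01 => /andP[x0 x1]; rewrite min_l// max_r.
Qed.

Lemma clamp01_homo : {homo @clamp01 R : x y / x <= y}.
Proof.
move=> x y xy; rewrite /clamp01; apply: le_max2 => //.
exact: le_min2.
Qed.

Lemma bounded_measurable_itv01 (f : R -> R) : {homo f : x y / x <= y} ->
  (forall x, f x \in `[0, 1]) -> bounded_measurable f.
Proof.
move=> fh f01; split; first exact: nondecreasing_measurable.
exists 1 => x; have := f01 x; rewrite in_itv/= => /andP[f0 f1].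
by rewrite ger0_norm.
Qed.

Lemma bounded_measurable_clamp01 : bounded_measurable (@clamp01 R).
Proof.
exact: bounded_measurable_itv01 clamp01_homo clamp01_itv.
Qed.

End Clamp.

(** * The uniform law *)

Section Uniform.
Context {R : realType} {U : probability R R}.
Hypothesis U_unif : forall B, measurable B -> U B = uniform_prob (@ltr01 R) B.
Implicit Types (f : R -> R) (x y : R).

(** The real line carries two measurable structures with the same measurable
    sets, one attached to real types and one generated by intervals, on which
    the uniform probability lives; the integral crosses from one to
    the other through the image measure under the identity. *)
Lemma mean_uniform f : bounded_measurable f -> (forall x, 0 <= f x) ->
  \int[U]_x f x = integral01 f.
Proof.
move=> [mf _] f0; rewrite /integral01 /Rintegral; congr fine.
have m_id : measurable_fun setT (idfun : measurableTypeR R -> R).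
  exact: measurable_id.
pose I : {mfun measurableTypeR R >-> R} :=
  @mfun_Sub _ _ (measurableTypeR R) R idfun (mem_set m_id).
transitivity (\int[distribution (uniform_prob (@ltr01 R)) I]_x (f x)%:E)%E.
  by apply: eq_measure_integral => A mA _; exact: U_unif.
rewrite ge0_integral_distribution//; last exact/measurable_EFinP.
rewrite [LHS]integral_uniform//; first by rewrite subr0 invr1 mul1e.
exact/measurable_EFinP.
Qed.

Lemma uniform_setI (A : set R) : measurable A ->
  U A = lebesgue_measure (A `&` `[0, 1]).
Proof.
move=> mA; rewrite U_unif// /uniform_prob integral_uniform_pdf.
rewrite (eq_integral (cst 1%E)) => [|x]; last first.
  by rewrite inE => -[_] /=; rewrite in_itv/= /uniform_pdf => ->;
    rewrite subr0 invr1.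
by rewrite integral_cst ?mul1e//; exact: measurableI.
Qed.

Lemma uniform_lt x : U `]-oo, x[%classic = (clamp01 x)%:E.
Proof.
rewrite uniform_setI// -set_itvI lebesgue_measure_itv/= meetEtotal.
rewrite lte_fin /clamp01 oppr0 adde0.
by case: ltP.
Qed.

Lemma uniform_gt x : U `]x, +oo[%classic = (1 - clamp01 x)%:E.
Proof.
rewrite uniform_setI// -set_itvI lebesgue_measure_itv/= joinEtotal lte_fin.
rewrite /clamp01 -EFinB.
have [x0|x0] := leP x 0.
  by rewrite min_l ?(le_trans x0)// max_l// ltr01.
have [x1|x1] := leP x 1; last first.
  by rewrite max_r// ltNge (ltW x1)/= subrr.
rewrite max_r ?(ltW x0)//; case: ltP => // x1'.
by rewrite (@le_anti _ _ x 1) ?x1// subrr.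
Qed.

Lemma mean_uniform_lt x : \int[U]_y (y < x)%R%:R = clamp01 x.
Proof.
rewrite -[RHS](_ : fine (U `]-oo, x[%classic) = _); last by rewrite uniform_lt.
rewrite -(setIT (`]-oo, x[%classic : set R)) -integral_indic//.
rewrite /Rintegral; congr fine; apply: eq_integral => y _.
rewrite indicE; congr (((nat_of_bool _)%:R)%:E); apply/idP/idP;
  by rewrite inE/= in_itv.
Qed.

Lemma mean_uniform_gt x : \int[U]_y (x < y)%R%:R = 1 - clamp01 x.
Proof.
rewrite -[RHS](_ : fine (U `]x, +oo[%classic) = _); last by rewrite uniform_gt.
rewrite -(setIT (`]x, +oo[%classic : set R)) -integral_indic//.
rewrite /Rintegral; congr fine; apply: eq_integral => y _.
rewrite indicE; congr (((nat_of_bool _)%:R)%:E); apply/idP/idP;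
  by rewrite inE/= in_itv/= andbT.
Qed.

(** The moments of the uniform law are the beta integrals B(n + 1, 1). *)
Lemma integral01X n : integral01 (fun x : R => x ^+ n) = n.+1%:R^-1.
Proof.
have := @beta_fun_fact R n 0; rewrite /beta_fun/= -Rintegral_mkcond => E.
rewrite /integral01.
transitivity (\int[@lebesgue_measure R]_(x in `[0, 1]) XMonemX n 0 x).
  by apply: eq_Rintegral => x _; rewrite /XMonemX expr0 mulr1.
rewrite {}E addn0 fact0 muln1 factS natrM invfM mulrCA divff ?mulr1//.
Qed.

Lemma mean_clampX n : \int[U]_x clamp01 x ^+ n = n.+1%:R^-1.
Proof.
rewrite -integral01X mean_uniform//; last 2 first.
- exact/bounded_measurableX/bounded_measurable_clamp01.
- move=> x; rewrite exprn_ge0//; have := clamp01_itv x.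
  by rewrite in_itv/= => /andP[].
by apply: eq_Rintegral => x; rewrite inE/= => x01; rewrite clamp01_id.
Qed.

End Uniform.

(** * The variance of a monotone function minus the identity *)

(** Half the gap between the first and second absolute moments of
    f(X) - f(Y), for independent X and Y of law [U]. *)
Definition variance_deficit {R : realType} (U : probability R R)
    (f : R -> R) : R :=
  2^-1 * \int[U]_x \int[U]_y (`|f x - f y| - (f x - f y) ^+ 2).

Section Gini.
Context {R : realType} {U : probability R R}.
Hypothesis U_unif : forall B, measurable B -> U B = uniform_prob (@ltr01 R) B.
Local Notation c := (@clamp01 R).
Variable f : R -> R.
Hypothesis bf : bounded_measurable f.

Let bc : bounded_measurable c := @bounded_measurable_clamp01 R.

Let order_sign (z : R * R) : R := (z.2 < z.1)%R%:R - (z.1 < z.2)%R%:R.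

Let b_order_sign : bounded_measurable order_sign.
Proof.
by apply: bounded_measurableB; apply: bounded_measurable_ltr.
Qed.

Let mean_order_sign x : \int[U]_y order_sign (x, y) = 2 * c x - 1.
Proof.
rewrite /order_sign/= meanB ?(mean_uniform_lt U_unif) ?(mean_uniform_gt U_unif);
  first lra.
- by apply: bounded_measurable_ltr => //; exact: measurable_cst.
- by apply: bounded_measurable_ltr => //; exact: measurable_cst.
Qed.

(** Monotonicity enters here only: it aligns the sign of f(x) - f(y) with that
    of x - y, which makes the absolute difference linear in f. *)
Lemma gini_mean_difference : {homo f : x y / x <= y} ->
  \int[U]_x \int[U]_y `|f x - f y| = 2 * \int[U]_x (f x * (2 * c x - 1)).
Proof.
move=> fh.
have normE x y :
    `|f x - f y| = f x * order_sign (x, y) + f y * order_sign (y, x).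
  rewrite /order_sign/=; case: (ltrgtP x y) => [xy|yx|->].
  - have := fh _ _ (ltW xy) => fxy.
    rewrite ler0_norm ?subr_le0//= mulr1n mulr0n.
    lra.
  - have := fh _ _ (ltW yx) => fxy.
    rewrite ger0_norm ?subr_ge0//= mulr1n mulr0n.
    lra.
  - by rewrite subrr normr0; lra.
pose h (z : R * R) := f z.1 * order_sign z.
pose h' (z : R * R) := h (z.2, z.1).
have bh : bounded_measurable h.
  by apply: bounded_measurableM => //; exact: bounded_measurable_comp bf.
have bh' : bounded_measurable h'.
  exact: bounded_measurable_comp (measurable_fun_pair _ _) bh.
transitivity (\int[(U \x U)%E]_z (h z + h' z)).
  rewrite Rintegral_prod; last exact: bounded_measurableD.
  by apply: eq_Rintegral => x _; apply: eq_Rintegral => y _; rewrite normE.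
rewrite meanD// !Rintegral_prod//.
(* Swapping the order of integration turns the second summand into the first. *)
rewrite [X in _ + X]Fubini_bounded// /h'/h/=.
have inner x : \int[U]_y (f x * order_sign (x, y)) = f x * (2 * c x - 1).
  rewrite meanZ ?mean_order_sign//.
  exact: bounded_measurable_comp (pair1_measurable x) b_order_sign.
set G := RHS.
transitivity
  (\int[U]_x (f x * (2 * c x - 1)) + \int[U]_x (f x * (2 * c x - 1))).
  by congr (_ + _); apply: eq_Rintegral => x _; exact: inner.
by rewrite /G; lra.
Qed.

Lemma mean_sqr_difference :
  \int[U]_x \int[U]_y (f x - f y) ^+ 2 =
  2 * (\int[U]_x f x ^+ 2 - (\int[U]_x f x) ^+ 2).
Proof.
set m := \int[U]_x f x; set q := \int[U]_x f x ^+ 2.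
have inner x : \int[U]_y (f x - f y) ^+ 2 = f x ^+ 2 - 2 * m * f x + q.
  have -> : (fun y => (f x - f y) ^+ 2) =
      (fun y => (f x ^+ 2 - (2 * f x) * f y) + f y ^+ 2).
    by apply/funext => y; lra.
  rewrite meanD ?meanB ?meanC ?meanZ -/m -/q; auto with bmeas; lra.
under eq_Rintegral do rewrite inner.
by rewrite meanD ?meanB ?meanC ?meanZ -/m -/q; auto with bmeas; lra.
Qed.

(** Expanding the square gives var(c) + var(f) - 2 cov(f, c), where c is the
    control variate; var(f) and cov(f, c) are the mean square difference and
    the Gini mean difference, up to factors 1/2 and 1/4. *)
Lemma variance_control_variate : {homo f : x y / x <= y} ->
  \int[U]_x (f x - c x - (\int[U]_z f z - 2^-1)) ^+ 2 =
  12^-1 - variance_deficit U f.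
Proof.
move=> fh.
have split_int : \int[U]_x \int[U]_y (`|f x - f y| - (f x - f y) ^+ 2) =
    \int[U]_x \int[U]_y `|f x - f y| - \int[U]_x \int[U]_y (f x - f y) ^+ 2.
  have bd : bounded_measurable (fun z : R * R => f z.1 - f z.2).
    by apply: bounded_measurableB; exact: bounded_measurable_comp bf.
  have bn := bounded_measurable_norm bd; have bs := bounded_measurableX 2 bd.
  by rewrite -(Rintegral_prod U U bn) -(Rintegral_prod U U bs)
             -(Rintegral_prod U U (bounded_measurableB bn bs)) -meanB.
rewrite /variance_deficit split_int gini_mean_difference// mean_sqr_difference.
set m := \int[U]_x f x; set q := \int[U]_x f x ^+ 2.
have c1 : \int[U]_x c x = 2^-1.
  by rewrite -(mean_clampX U_unif 1); apply: eq_Rintegral => x _; rewrite expr1.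
have c2 : \int[U]_x c x ^+ 2 = 3^-1 := mean_clampX U_unif 2.
have bfc : bounded_measurable (fun x => f x * c x).
  exact: bounded_measurableM.
set k := m - 2^-1; set p := \int[U]_x (f x * c x).
have -> : \int[U]_x (f x * (2 * c x - 1)) = 2 * p - m.
  rewrite -meanZ// -meanB//; last by auto with bmeas.
  by apply: eq_Rintegral => x _; lra.
have -> : \int[U]_x (f x - c x - k) ^+ 2 =
    \int[U]_x (f x ^+ 2 + c x ^+ 2 + k ^+ 2 - 2 * (f x * c x)
               - (2 * k) * f x + (2 * k) * c x).
  by apply: eq_Rintegral => x _; lra.
rewrite meanD ?meanB ?meanD ?meanZ ?meanC; auto 20 with bmeas.
rewrite c1 c2 -/m -/q -/p /k; lra.
Qed.

End Gini.

(** Two values in [0,1] are at distance t <= 1, and t^2 <= t. *)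
Lemma variance_deficit_ge0 (R : realType) (U : probability R R) (f : R -> R) :
  (forall x, f x \in `[0, 1]) -> 0 <= variance_deficit U f.
Proof.
move=> f01; rewrite mulr_ge0 ?invr_ge0//.
apply: Rintegral_ge0 => x _; apply: Rintegral_ge0 => y _.
rewrite -(real_normK (num_real (f x - f y))) subr_ge0 expr2.
rewrite ler_piMl// ler_norml.
have := f01 x; have := f01 y; rewrite !in_itv/= => /andP[? ?] /andP[? ?].
by apply/andP; split; lra.
Qed.

(** The distance of two values among 0 and 1 is its own square; this is the
    equality case of the variance bound. *)
Lemma variance_deficit_indic (R : realType) (U : probability R R) (f : R -> R) :
  (forall x, f x = 0 \/ f x = 1) -> variance_deficit U f = 0.
Proof.
move=> f01.
have gap0 x y : `|f x - f y| - (f x - f y) ^+ 2 = 0.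
  by case: (f01 x) => ->; case: (f01 y) => ->;
    rewrite ?subrr ?subr0 ?sub0r ?normrN ?normr1 ?normr0 ?sqrrN ?expr1n
      ?expr0n/= ?subrr.
rewrite /variance_deficit -[RHS](mulr0 2^-1) -[X in _ = _ * X](meanC U).
congr (_ * _).
apply: eq_Rintegral => x _; rewrite -[RHS](meanC U).
by apply: eq_Rintegral => y _.
Qed.


(** * Sample means *)

Section SampleMean.
Context {R : realType} {d : measure_display} {T : measurableType d}.
Variables (P : probability T R) (n : nat) (X : 'I_n -> {RV P >-> R}).

Lemma mutually_independent_pair i j (A B : set R) :
  mutually_independent X -> i != j -> measurable A -> measurable B ->
  (P (X i @^-1` A `&` X j @^-1` B) = P (X i @^-1` A) * P (X j @^-1` B))%E.
Proof.
move=> indep ij mA mB.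
pose C k := if k == i then A else B.
have Ci : C i = A by rewrite /C eqxx.
have Cj : C j = B by rewrite /C eq_sym (negbTE ij).
have mC k : measurable (C k) by rewrite /C; case: ifP.
have := indep [set i; j]%SET C mC.
rewrite big_setU1 ?inE//= big_set1 Ci Cj => <-; congr (P _).
apply/seteqP; split => [t [iA jB] k /=|t tC].
  by rewrite !inE => /orP[] /eqP ->; rewrite ?Ci ?Cj.
by split; [rewrite -Ci; apply: tC | rewrite -Cj; apply: tC];
  rewrite /= !inE eqxx ?orbT.
Qed.

Variable U : probability R R.
Hypothesis X_indep : mutually_independent X.
Hypothesis X_law : forall i B, measurable B -> distribution P (X i) B = U B.

Lemma mean_sample_mean g : (0 < n)%N -> bounded_measurable g ->
  \int[P]_t (n%:R^-1 * \sum_(i < n) g (X i t)) = \int[U]_x g x.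
Proof.
move=> n0 bg.
have bgX i : bounded_measurable (fun t => g (X i t)).
  exact: bounded_measurable_comp bg.
rewrite meanZ; last exact: bounded_measurable_sum.
rewrite mean_sum// (eq_bigr (fun=> \int[U]_x g x)) => [|i _]; last first.
  exact: (mean_distribution (X_law i) bg).
by rewrite sumr_const card_ord -[X in _ * X]mulr_natl mulKf// pnatr_eq0 -lt0n.
Qed.

(** Among the n^2 products of the expanded square only the n diagonal ones have
    a nonzero mean, since the others factor by independence into means of the
    centered function [h]. *)
Lemma mean_sqr_sample_mean h : bounded_measurable h -> \int[U]_x h x = 0 ->
  \int[P]_t (n%:R^-1 * \sum_(i < n) h (X i t)) ^+ 2 =
  n%:R^-1 * \int[U]_x h x ^+ 2.
Proof.
move=> bh h0.
have bhX i : bounded_measurable (fun t => h (X i t)).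
  exact: bounded_measurable_comp bh.
have bhXX i j : bounded_measurable (fun t => h (X i t) * h (X j t)).
  exact: bounded_measurableM.
have meanX i k : bounded_measurable k -> \int[P]_t k (X i t) = \int[U]_x k x.
  by move=> bk; exact: (mean_distribution (X_law i) bk).
have meanXX i j : \int[P]_t (h (X i t) * h (X j t)) =
    if j == i then \int[U]_x h x ^+ 2 else 0.
  case: eqVneq => [->|ji].
    by rewrite -(meanX i)//; exact: bounded_measurableX.
  rewrite mean_indep//; first by rewrite !meanX// h0 mul0r.
  by move=> A B; apply: mutually_independent_pair; rewrite // eq_sym.
transitivity (\int[P]_t
    (n%:R^-1 ^+ 2 * \sum_(i < n) \sum_(j < n) (h (X i t) * h (X j t)))).
  by apply: eq_Rintegral => t _; rewrite exprMn [X in _ * X]expr2 big_distrlr.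
have bsum i :
    bounded_measurable (fun t => \sum_(j < n) (h (X i t) * h (X j t))).
  exact: bounded_measurable_sum.
rewrite meanZ; last exact: bounded_measurable_sum.
rewrite mean_sum//.
under eq_bigr => i _.
  rewrite mean_sum//; under eq_bigr do rewrite meanXX.
  rewrite -big_mkcond big_pred1_eq; over.
rewrite sumr_const card_ord -[X in _ * X]mulr_natl expr2 -mulrA.
have [->|n0] := eqVneq n 0%N; first by rewrite invr0 !mul0r.
by rewrite mulKf// pnatr_eq0.
Qed.

End SampleMean.

(** * The control variate estimator *)

Section ControlVariate.
Context {R : realType} {d : measure_display} {T : measurableType d}.
Variables (P : probability T R) (n : nat) (X : 'I_n -> {RV P >-> R}).
Hypothesis n_gt0 : (0 < n)%N.
Hypothesis X_indep : mutually_independent X.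
Hypothesis X_unif : forall i, uniform01 (X i).

Let Shat := control_variate (fun i => X i : T -> R).
Variable U : probability R R.
Hypothesis U_unif : forall B, measurable B -> U B = uniform_prob (@ltr01 R) B.

Let X_law i B : measurable B -> distribution P (X i) B = U B.
Proof. by move=> mB; have [_ ->//] := X_unif i; rewrite U_unif. Qed.

Section Input.
Variable f : R -> R.
Hypothesis f_mon : monotone_class f.

Let g x := f (clamp01 x).

Let g_homo : {homo g : x y / x <= y}.
Proof.
by move=> x y xy; apply: f_mon.1; [exact: clamp01_itv..|exact: clamp01_homo].
Qed.

Let g_itv x : g x \in `[0, 1].
Proof. exact/f_mon.2/clamp01_itv. Qed.

Let bg : bounded_measurable g.
Proof. exact: bounded_measurable_itv01. Qed.

Let mean_g : \int[U]_x g x = integral01 f.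
Proof.
rewrite (mean_uniform U_unif)//; last first.
  by move=> x; have := g_itv x; rewrite in_itv/= => /andP[].
by apply: eq_Rintegral => x; rewrite inE/= => x01; rewrite /g clamp01_id.
Qed.

Let h x := g x - clamp01 x - (integral01 f - 2^-1).

Let bh : bounded_measurable h.
Proof.
apply: bounded_measurableB; last exact: bounded_measurable_cst.
by apply: bounded_measurableB => //; exact: bounded_measurable_clamp01.
Qed.

Let mean_h : \int[U]_x h x = 0.
Proof.
have c1 : \int[U]_x clamp01 x = 2^-1.
  by rewrite -(mean_clampX U_unif 1); apply: eq_Rintegral => x _; rewrite expr1.
have bc := @bounded_measurable_clamp01 R.
rewrite /h !meanB ?meanC ?mean_g ?c1 ?subrr//; auto with bmeas.
Qed.

Lemma control_variate_error t :
  Shat f t - integral01 f = n%:R^-1 * \sum_(i < n) h (X i t).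
Proof.
rewrite /Shat /control_variate /h [in RHS]sumrB sumr_const card_ord [RHS]mulrBr.
rewrite -[X in _ = _ - _ * X]mulr_natl mulKf ?pnatr_eq0 -?lt0n//.
rewrite (eq_bigr (fun i => g (X i t) - clamp01 (X i t))) => [|i _];
  first by lra.
by have [/(_ t) X01 _] := X_unif i; rewrite /g clamp01_id.
Qed.

Let b_mean : bounded_measurable (fun t => n%:R^-1 * \sum_(i < n) h (X i t)).
Proof.
apply: bounded_measurableM; first exact: bounded_measurable_cst.
by apply: bounded_measurable_sum => i; exact: bounded_measurable_comp bh.
Qed.

Lemma control_variate_unbiased : 'E_P[Shat f]%E = (integral01 f)%:E.
Proof.
have E : Shat f = fun t => n%:R^-1 * (\sum_(i < n) h (X i t)) + integral01 f.
  by apply/funext => t; rewrite -control_variate_error subrK.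
rewrite E expectation_Rintegral; last by auto with bmeas.
rewrite meanD ?meanC//; last by auto with bmeas.
by rewrite (mean_sample_mean X_law)// mean_h add0r.
Qed.

Lemma mean_sqr_control_variate_error :
  'E_P[fun t => ((Shat f t - integral01 f) ^+ 2)%R]%E =
  (n%:R^-1 * (12^-1 - variance_deficit U (f \o @clamp01 R)))%:E.
Proof.
under [X in expectation _ X]eq_fun do rewrite control_variate_error.
rewrite expectation_Rintegral; last exact: bounded_measurableX.
rewrite (mean_sqr_sample_mean X_indep X_law)// /h -mean_g.
by rewrite variance_control_variate.
Qed.

Lemma variance_control_variate_estimator :
  'V_P[Shat f]%E =
  (n%:R^-1 * (12^-1 - variance_deficit U (f \o @clamp01 R)))%:E.
Proof.
rewrite -mean_sqr_control_variate_error /variance unlock.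
by rewrite control_variate_unbiased/=; congr expectation.
Qed.

(** The estimator is unbiased, so its mean squared error is its variance. *)
Lemma L2_error_control_variate :
  L2_error P Shat f = ('V_P[Shat f] `^ 2^-1)%E.
Proof.
rewrite variance_control_variate_estimator -mean_sqr_control_variate_error.
rewrite /L2_error.
congr (_ `^ _)%E; congr expectation; apply/funext => t.
by rewrite real_normK ?num_real// -sqrrN opprB.
Qed.

End Input.

End ControlVariate.

Lemma unit_step_monotone (R : realType) (x0 : R) :
  monotone_class (unit_step x0).
Proof.
split => [x y|x _].
  rewrite !in_itv/= => /andP[x0' x1] /andP[y0 y1] xy.
  rewrite /unit_step !indicE.
  case: (boolP (x \in _)) => [|_]; last by rewrite ler0n.
  rewrite inE/= in_itv/= => /andP[x0x _].
  by rewrite mem_set//= in_itv/= y1 (le_trans x0x xy).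
by rewrite in_itv/= /unit_step indicE ler0n lern1 leq_b1.
Qed.

Unset Implicit Arguments.
Set Strict Implicit.

Theorem theorem3p1 (R : realType) (d : measure_display) (T : measurableType d)
    (P : probability T R) (n : nat) (X : 'I_n -> {RV P >-> R})
    (n_ge1 : (1 <= n)%N)
    (X_indep : mutually_independent X)
    (X_unif : forall i, uniform01 (X i)) :
  let Shat := control_variate (fun i => X i : T -> R) in
  [/\ unbiased P Shat,
      (e2 P Shat ^+ 2)%E = ((12 * n%:R)^-1)%:E,
      is_max [set 'V_P[Shat f]%E | f in @monotone_class R]
        ((12 * n%:R)^-1)%:E &
      forall x0 : R, x0 \in `[0, 1] ->
        monotone_class (unit_step x0) /\
        L2_error P Shat (unit_step x0) = e2 P Shat /\
        'V_P[Shat (unit_step x0)]%E = ((12 * n%:R)^-1)%:E].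
Proof.
move=> Shat.
(* Any of the samples provides the common law; there is one since n >= 1. *)
pose U : probability R R := distribution P (X (Ordinal n_ge1)).
have U_unif B : measurable B -> U B = uniform_prob (@ltr01 R) B.
  by have [_] := X_unif (Ordinal n_ge1); exact.
have varE f : monotone_class f -> 'V_P[Shat f]%E =
    (n%:R^-1 * (12^-1 - variance_deficit U (f \o @clamp01 R)))%:E.
  exact: variance_control_variate_estimator.
set v : R := (12 * n%:R)^-1.
have v_ge0 : 0 <= v by rewrite invr_ge0 mulr_ge0.
have var_le f : monotone_class f -> ('V_P[Shat f] <= v%:E)%E.
  move=> f_mon; rewrite varE// lee_fin.
  rewrite /v invfM mulrC ler_wpM2r ?invr_ge0//.
  rewrite gerBl variance_deficit_ge0// => x.
  exact/f_mon.2/clamp01_itv.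
have var_step x0 : 'V_P[Shat (unit_step x0)]%E = v%:E.
  rewrite varE; last exact: unit_step_monotone.
  rewrite variance_deficit_indic ?subr0; last first.
    by move=> x; rewrite /= /unit_step indicE; case: (_ \in _); [right|left].
  by rewrite /v invfM mulrC.
have L2_step x0 : L2_error P Shat (unit_step x0) = (v `^ 2^-1)%:E.
  rewrite (L2_error_control_variate n_ge1 X_indep X_unif U_unif); last first.
    exact: unit_step_monotone.
  by rewrite var_step poweR_EFin.
have e2E : e2 P Shat = (v `^ 2^-1)%:E.
  apply/le_anti/andP; split.
    apply: ub_ereal_sup => _ [f f_mon <-].
    rewrite (L2_error_control_variate n_ge1 X_indep X_unif U_unif)//.
    rewrite -poweR_EFin.
    apply: gt0_ler_poweR; rewrite ?invr_ge0 ?var_le// in_itv/= leey andbT//.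
    exact: variance_ge0.
  apply: ereal_sup_ubound.
  by exists (unit_step 0); [exact: unit_step_monotone|].
split.
- by move=> f f_mon; exact: (control_variate_unbiased n_ge1 X_unif U_unif).
- by rewrite e2E -EFin_expe powR12_sqrt// sqr_sqrtr.
- split; first by exists (unit_step 0); [exact: unit_step_monotone|].
  by move=> _ [f f_mon <-]; exact: var_le.
- move=> x0 _; split; first exact: unit_step_monotone.
  by rewrite L2_step e2E var_step.
Qed.
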